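(* Let $m_1,m_2,t_{16}\in\mathbb{R}$ and let $\mathfrak g$ be the real linear span of $E_1=\begin{pmatrix} -2m_1-2im_2&0&im_1(m_1+im_2)&1\\0&2im_2&0&0\\4i&0&2m_1&0\\0&0&0&0\end{pmatrix}$, $E_2=\begin{pmatrix} 2m_2&0&0&i\\0&2m_2+it_{16}&0&0\\0&0&2m_2&0\\0&0&0&0\end{pmatrix}$, $E_3=\begin{pmatrix}0&-m_1-im_2&0&0\\-2im_2&0&-m_1m_2&1\\0&2i&0&0\\0&0&0&0\end{pmatrix}$, $E_4=\begin{pmatrix}0&im_1-m_2&0&0\\2m_2&0&-im_1m_2&i\\0&2&0&0\\0&0&0&0\end{pmatrix}$, $E_5=\begin{pmatrix}-m_1m_2&0&0&0\\0&-\frac12 m_1(2m_2+it_{16})&0&0\\0&0&-m_1m_2&1\\0&0&0&0\end{pmatrix}$. Then every integral variety of type $(1/2,0)$ related to $\mathfrak g$ is affinely equivalent to (an open piece of) one of the hypersurfaces 1) $v=2x_1^2+|z_2|^2$; 2) $v^2=|z_1|^2+|z_2|^2$.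
   Context: Coordinates in $\mathbb{C}^3$ are $z_1=x_1+iy_1$, $z_2=x_2+iy_2$, $w=u+iv$, $z=(z_1,z_2)$. To a complex $4\times4$ matrix $\begin{pmatrix}a_1&a_2&a_3&p\\ b_1&b_2&b_3&s\\ c_1&c_2&c_3&q\\0&0&0&0\end{pmatrix}$ one associates the holomorphic affine vector field $Z=(a_1z_1+a_2z_2+a_3w+p)\frac{\partial}{\partial z_1}+(b_1z_1+b_2z_2+b_3w+s)\frac{\partial}{\partial z_2}+(c_1z_1+c_2z_2+c_3w+q)\frac{\partial}{\partial w}$. For a real linear span $\mathfrak g$ of such matrices, an integral variety of type $(1/2,0)$ related to $\mathfrak g$ is a real-analytic strictly pseudoconvex real hypersurface $M$ defined near $0\in\mathbb{C}^3$, with $0\in M$, given near $0$ by an equation $v=|z_1|^2+|z_2|^2+\frac12(z_1^2+\bar z_1^2)+\sum_{k+l+2m\ge 3}F_{klm}(z,\bar z)u^m$ (with $F_{klm}$ a polynomial of degree $k$ in $z$ and $l$ in $\bar z$, the right-hand side real), such that for every $Z\in\mathfrak g$ the real vector field $Z+\bar Z$ is tangent to $M$, i.e. $\mathrm{Re}(Z(\Phi))|_M=0$ for a defining function $\Phi$ of $M$. Two hypersurfaces are affinely equivalent if a complex affine transformation of $\mathbb{C}^3$ maps a neighbourhood in one onto an open piece of the other. *)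

(* Defs.v *)
From HB Require Import structures.
From mathcomp Require Import all_boot all_order all_algebra.
From mathcomp Require Import all_classical all_reals all_analysis.
From mathcomp Require Import complex.

Set Implicit Arguments. Unset Strict Implicit. Unset Printing Implicit Defensive.
Import Order.TTheory GRing.Theory Num.Theory numFieldNormedType.Exports.
Local Open Scope ring_scope.
Local Open Scope complex_scope.
Local Open Scope classical_set_scope.

Section Defs.
Variable R : realType.
Local Notation C := R[i].

Definition pt := 'cV[C]_3.
Definition reC (z : C) : R := complex.Re z.
Definition imC (z : C) : R := complex.Im z.
Definition z1 (p : pt) : C := p 0 0.
Definition z2 (p : pt) : C := p 1 0.
Definition zw (p : pt) : C := p 2%:R 0.

Definition mx4 (rows : seq (seq C)) : 'M[C]_4 :=
  \matrix_(i < 4, j < 4) nth 0 (nth [::] rows i) j.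

Definition vfield (E : 'M[C]_4) (p : pt) : pt :=
  \col_(k < 3) (E (inord k) 0 * z1 p + E (inord k) 1 * z2 p
                + E (inord k) 2%:R * zw p + E (inord k) 3%:R).

Definition coords5 (p : pt) : 'I_5 -> R :=
  fun i => nth 0 [:: reC (z1 p); imC (z1 p); reC (z2 p); imC (z2 p); reC (zw p)] i.

(* Real-analyticity at 0 of a function of 5 real variables:
   an absolutely convergent power series on a polydisc around 0.
   Box partial sums: multi-indices a with every a i < N. *)
Definition psum (c : ('I_5 -> nat) -> R) (N : nat) (x : 'I_5 -> R) : R :=
  \sum_(a : {ffun 'I_5 -> 'I_N}) c (fun i => nat_of_ord (a i)) *
                                  \prod_(i < 5) x i ^+ a i.
Definition pabssum (c : ('I_5 -> nat) -> R) (N : nat) (x : 'I_5 -> R) : R :=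
  \sum_(a : {ffun 'I_5 -> 'I_N}) `|c (fun i => nat_of_ord (a i)) *
                                  \prod_(i < 5) x i ^+ a i|.

Definition has_power_series (f : ('I_5 -> R) -> R) (c : ('I_5 -> nat) -> R) :=
  exists2 r : R, 0 < r &
    forall x : 'I_5 -> R, (forall i, `|x i| < r) ->
      (exists M : R, forall N, pabssum c N x <= M) /\
      ((fun N => psum c N x) @ \oo --> f x).

Definition wdeg (a : 'I_5 -> nat) : nat := (a (inord 0) + a (inord 1) + a (inord 2) + a (inord 3) + 2 * a (inord 4))%N.

(* F is in the normal form  |z1|^2+|z2|^2+ 1/2(z1^2+bar z1^2) + sum_{k+l+2m>=3} F_klm u^m,
   i.e. F = 2 x1^2 + x2^2 + y2^2 + G with G real-analytic at 0 whose power series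
   only has monomials of weighted degree >= 3. *)
Definition normal_form (F : ('I_5 -> R) -> R) :=
  exists G : ('I_5 -> R) -> R,
    (forall x, F x = 2 * x 0 ^+ 2 + x 2%:R ^+ 2 + x 3%:R ^+ 2 + G x) /\
    exists2 c, has_power_series G c & forall a, (wdeg a <= 2)%N -> c a = 0.

Definition graph_hyp (F : ('I_5 -> R) -> R) (rho : R) : set pt :=
  [set p : pt | (forall i, `|p i 0| < rho%:C) /\ imC (zw p) = F (coords5 p)].

Definition defun (F : ('I_5 -> R) -> R) (p : pt) : R := F (coords5 p) - imC (zw p).

(* Re(Z(Phi)) = 0 on M, i.e. Z + bar Z tangent to M: the real derivative of Phi
   along the real direction Z(p) vanishes at every point p of M. *)
Definition tangent_on (E : 'M[C]_4) (F : ('I_5 -> R) -> R) (M : set pt) :=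
  forall p, M p ->
    is_derive (0 : R) (1 : R) (fun t : R => defun F (p + t%:C *: vfield E p)) 0.

Definition open3 (S : set pt) :=
  forall p, S p -> exists2 e : R, 0 < e &
    forall q : pt, (forall i, `|q i 0 - p i 0| < e%:C) -> S q.

(* M (a germ at 0) is affinely equivalent to (an open piece of) N. *)
Definition aff_equiv_to (M N : set pt) :=
  exists (L : 'M[C]_3) (b : pt), L \in unitmx /\
    exists U V : set pt, [/\ open3 U, U 0, open3 V &
      [set L *m p + b | p in M `&` U] = N `&` V].

Definition model1 : set pt :=
  [set p : pt | imC (zw p) = 2 * reC (z1 p) ^+ 2 + (reC (z2 p) ^+ 2 + imC (z2 p) ^+ 2)].
Definition model2 : set pt :=
  [set p : pt | imC (zw p) ^+ 2 = (reC (z1 p) ^+ 2 + imC (z1 p) ^+ 2)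
                           + (reC (z2 p) ^+ 2 + imC (z2 p) ^+ 2)].

Variables (m1 m2 t16 : R).
Local Notation "x %:c" := (x%:C : C) (at level 2, format "x %:c").
Definition E1 : 'M[C]_4 := mx4
  [:: [:: - 2 * m1%:c - 2 * 'i * m2%:c; 0; 'i * m1%:c * (m1%:c + 'i * m2%:c); 1];
      [:: 0; 2 * 'i * m2%:c; 0; 0];
      [:: 4 * 'i; 0; 2 * m1%:c; 0];
      [:: 0; 0; 0; 0]].
Definition E2 : 'M[C]_4 := mx4
  [:: [:: 2 * m2%:c; 0; 0; 'i];
      [:: 0; 2 * m2%:c + 'i * t16%:c; 0; 0];
      [:: 0; 0; 2 * m2%:c; 0];
      [:: 0; 0; 0; 0]].
Definition E3 : 'M[C]_4 := mx4
  [:: [:: 0; - m1%:c - 'i * m2%:c; 0; 0];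
      [:: - 2 * 'i * m2%:c; 0; - m1%:c * m2%:c; 1];
      [:: 0; 2 * 'i; 0; 0];
      [:: 0; 0; 0; 0]].
Definition E4 : 'M[C]_4 := mx4
  [:: [:: 0; 'i * m1%:c - m2%:c; 0; 0];
      [:: 2 * m2%:c; 0; - 'i * m1%:c * m2%:c; 'i];
      [:: 0; 2; 0; 0];
      [:: 0; 0; 0; 0]].
Definition E5 : 'M[C]_4 := mx4
  [:: [:: - m1%:c * m2%:c; 0; 0; 0];
      [:: 0; - (1 / 2) * m1%:c * (2 * m2%:c + 'i * t16%:c); 0; 0];
      [:: 0; 0; - m1%:c * m2%:c; 1];
      [:: 0; 0; 0; 0]].

Definition in_g (Z : 'M[C]_4) :=
  exists c : 'I_5 -> R,
    Z = (c 0)%:c *: E1 + (c 1)%:c *: E2 + (c 2%:R)%:c *: E3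
        + (c 3%:R)%:c *: E4 + (c 4%:R)%:c *: E5.

End Defs.

Definition integral_variety (R : realType) (g : 'M[R[i]]_4 -> Prop)
    (F : ('I_5 -> R) -> R) (rho : R) :=
  [/\ 0 < rho, normal_form F &
      forall Z, g Z -> tangent_on Z F (graph_hyp F rho)].

(* Main.v *)
Require Import Defs.
From HB Require Import structures.
From mathcomp Require Import all_boot all_order all_algebra.
From mathcomp Require Import all_classical all_reals all_analysis.
From mathcomp Require Import complex ring lra.

(** The affine coordinate zeta = z1 - (i m1 / 2) w turns E5 + (m1 / 2) E2 into
    the translation d/dw and removes m1 from all the fields.  In these coordinates
    the quadric
      Q = v - 2 (Re zeta)^2 - |z2|^2 + 2 m2 v Im zeta + m2^2 v^2 / 2
    is a relative invariant: Re (Z Q) = lambda Q for every Z in g, with lambda a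
    real constant depending linearly on Z.  Near 0 the fields of g are a frame of
    the hypersurface M : v = F(x), so along the ray s |-> (s x, F (s x)) the
    derivative of F is prescribed by g, and Q satisfies a linear ODE with Q = 0 at
    s = 0.  Hence Q = 0 on M, and as Q is strictly monotone in v near 0, M is the
    quadric Q = 0 near 0.  This is model 1 when m2 = 0 and, after completing
    squares, model 2 when m2 <> 0. *)

Set Implicit Arguments. Unset Strict Implicit. Unset Printing Implicit Defensive.
Import Order.TTheory GRing.Theory Num.Theory numFieldNormedType.Exports.
Local Open Scope ring_scope.
Local Open Scope complex_scope.
Local Open Scope classical_set_scope.

Section AffineQuadrics.
Variable R : realType.

(** * Preliminary estimates: a linear ODE, matrices near the identity, power series *)

(** The weight [expR (- (2 * K) * t)] makes [f ^+ 2] nonincreasing, and a nonnegative nonincreasing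
    function that starts at 0 stays 0. The coefficient [l] is chosen separately at each [t], with no
    continuity, as it will come from a pointwise linear system. *)
Lemma gronwall0 (f : R -> R) (K : R) :
  (forall t : R, 0 <= t <= 1 ->
     exists2 l, is_derive t 1 f (l * f t) & `|l| <= K) ->
  f 0 = 0 -> f 1 = 0.
Proof.
move=> df f0.
pose h (t : R) := expR (- (2 * K) * t) * f t ^+ 2.
have dh (t : R) : 0 <= t <= 1 -> exists2 d, is_derive t 1 h d & d <= 0.
  move=> t01; have [l dft lK] := df t t01.
  exists (expR (- (2 * K) * t) * (2 * (l - K) * f t ^+ 2)).
    by apply: is_derive_eq; rewrite /GRing.scale /=; ring.
  rewrite mulr_ge0_le0 ?expR_ge0// mulr_le0_ge0 ?sqr_ge0//.
  have := ler_norm l; lra.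
have h10 : h 1 <= h 0.
  have hcc : {in `[0, 1]%R, forall t : R, 0 <= t <= 1}.
    by move=> t; rewrite in_itv.
  have hoo : {in `]0, 1[%R, forall t : R, 0 <= t <= 1}.
    by move=> t; rewrite in_itv /= => /andP[/ltW-> /ltW->].
  apply: (@ler0_derive1_le_cc _ h 0 1).
  - by move=> t /hoo /dh[d []].
  - by move=> t /hoo /dh[d dht d0]; rewrite derive1E derive_val.
  - by apply: derivable_within_continuous => t /hcc /dh[d []].
  - by rewrite bound_itvE.
  - by rewrite bound_itvE.
  - by [].
move: h10; rewrite /h f0 expr0n mulr0 pmulr_rle0 ?expR_gt0// => f1.
by apply/eqP; rewrite -sqrf_eq0 eq_le f1 sqr_ge0.
Qed.

(** At an index [k] where [c] has its largest entry, the perturbation [c *m D] cancels at most half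
    of that entry. *)
Lemma near1_bound n (D : 'M[R]_n) (c : 'rV[R]_n) (e : R) :
  (forall i j, `|D i j| <= (2 * n%:R)^-1) ->
  (forall j, `|(c *m (1%:M + D)) 0 j| <= e) -> forall j, `|c 0 j| <= 2 * e.
Proof.
case: n D c => [|n] D c hD hc j; first by case: j.
have [k _ kmax] := arg_maxP (fun k => `|c 0 k|) (erefl (xpredT j)).
have {}kmax i : `|c 0 i| <= `|c 0 k| by exact: kmax.
apply: le_trans (kmax j) _.
have := hc k; rewrite mulmxDr mulmx1 mxE => hk.
have hS : `|(c *m D) 0 k| <= `|c 0 k| / 2.
  rewrite mxE (le_trans (ler_norm_sum _ _ _))//.
  have -> : `|c 0 k| / 2 = \sum_(i < n.+1) `|c 0 k| * (2 * n.+1%:R)^-1.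
    rewrite sumr_const card_ord -mulr_natl. field.
    by rewrite nat1r pnatr_eq0.
  by apply: ler_sum => i _; rewrite normrM ler_pM.
have := lerB_normD (c 0 k) ((c *m D) 0 k); lra.
Qed.

Lemma near1_solve n (D : 'M[R]_n) (xi : 'rV[R]_n) (e : R) :
  (forall i j, `|D i j| <= (2 * n%:R)^-1) -> (forall j, `|xi 0 j| <= e) ->
  exists2 c : 'rV[R]_n, c *m (1%:M + D) = xi & forall j, `|c 0 j| <= 2 * e.
Proof.
(* The bound with [e] equal to 0 shows that the kernel is trivial. *)
move=> hD hxi; have uD : 1%:M + D \in unitmx.
  rewrite -row_free_unit; apply: inj_row_free => v v0.
  apply/rowP => j; rewrite mxE; apply/eqP; rewrite -normr_le0.
  rewrite -(mulr0 2); apply: near1_bound hD _ _ => k.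
  by rewrite v0 mxE normr0.
exists (xi *m invmx (1%:M + D)); first by rewrite mulmxKV.
by apply: near1_bound hD _ => j; rewrite mulmxKV.
Qed.

(** The constant coefficient vanishes, so every remaining monomial has at least one factor [s] when
    compared with its value at the point with all coordinates [r / 2]. *)
Lemma power_series_small (f : ('I_5 -> R) -> R) c :
  has_power_series f c -> (forall a, (wdeg a <= 2)%N -> c a = 0) ->
  exists r M : R, 0 < r /\ forall s x, 0 <= s <= 1 ->
    (forall i, `|x i| <= s * r) -> `|f x| <= s * M.
Proof.
move=> [r r0 hf] c0.
have [|[M hM] _] := hf (fun=> r / 2).
  by move=> i; rewrite ger0_norm; lra.
exists (r / 2), M; split; first lra.
move=> s x /andP[s0 s1] hx.
have [|_ fx] := hf x.
  move=> i; apply: le_lt_trans (hx i) _; nra.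
suff bN N : `|psum c N x| <= s * M.
  have : `|psum c N x| @[N --> \oo] --> `|f x| by exact: cvg_norm.
  move=> cv; apply: (@closed_cvg _ _ _ _ _ (fun y : R => y <= s * M) _ _ _ cv).
  - exact: closed_le.
  - exact: nearW.
apply: le_trans (ler_norm_sum _ _ _) _.
apply: le_trans (ler_wpM2l s0 (hM N)); rewrite /pabssum mulr_sumr.
apply: ler_sum => a _.
have [a0|a0] := eqVneq (\sum_(i < 5) a i)%N 0%N.
  rewrite c0 ?mul0r ?normr0 ?mulr0//.
  have a00 i : (a i : nat) = 0%N.
    by move/eqP: a0; rewrite sum_nat_eq0 => /forallP/(_ i)/eqP.
  by rewrite /wdeg !a00.
rewrite !normrM mulrCA ler_wpM2l// !normr_prod.
apply: (@le_trans _ _ (\prod_(i < 5) (s ^+ a i * `|(r / 2) ^+ a i|))).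
  apply: ler_prod => i _; rewrite normr_ge0/= !normrX -exprMn.
  rewrite lerXn2r ?nnegrE ?mulr_ge0// (ger0_norm (x := r / 2)) ?hx//; lra.
rewrite big_split /= ler_wpM2r ?prodr_ge0//.
rewrite -expr_sum.
rewrite -[leRHS]expr1 ler_wiXn2l// lt0n//.
Qed.

Implicit Types (x : 'I_5 -> R) (v : R).

(** * The fields of g in real coordinates *)

(** Inverse of the pair ([coords5], Im w). Keeping [v] independent of [F] turns statements about the
    fields into polynomial identities in six real variables. *)
Definition graph_pt x v : pt R :=
  \col_(k < 3) nth 0 [:: x 0 +i* x 1; x 2%:R +i* x 3%:R; x 4%:R +i* v] k.

Definition basis_field m1 m2 t16 (k : 'I_5) : 'M[R[i]]_4 :=
  nth 0 [:: E1 m1 m2; E2 m2 t16; E3 m1 m2; E4 m1 m2; E5 m1 m2 t16] k.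

(* Row k lists Re z1, Im z1, Re z2, Im z2, Re w, Im w of E_(k+1) at the point
   [graph_pt x v]. *)
Definition basis_field_re (m1 m2 t : R) x v : seq (seq R) :=
  let x0 := x 0 in let y0 := x 1 in let x2 := x 2%:R in let y2 := x 3%:R in
  let u := x 4%:R in
  [:: [:: - 2 * m1 * x0 + 2 * m2 * y0 - m1 * m2 * u - m1 ^+ 2 * v + 1;
          - 2 * m1 * y0 - 2 * m2 * x0 - m1 * m2 * v + m1 ^+ 2 * u;
          - 2 * m2 * y2; 2 * m2 * x2;
          - 4 * y0 + 2 * m1 * u; 4 * x0 + 2 * m1 * v];
      [:: 2 * m2 * x0; 2 * m2 * y0 + 1;
          2 * m2 * x2 - t * y2; 2 * m2 * y2 + t * x2; 2 * m2 * u; 2 * m2 * v];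
      [:: - m1 * x2 + m2 * y2; - m1 * y2 - m2 * x2;
          2 * m2 * y0 - m1 * m2 * u + 1; - 2 * m2 * x0 - m1 * m2 * v;
          - 2 * y2; 2 * x2];
      [:: - m1 * y2 - m2 * x2; m1 * x2 - m2 * y2;
          2 * m2 * x0 + m1 * m2 * v; 2 * m2 * y0 - m1 * m2 * u + 1;
          2 * x2; 2 * y2];
      [:: - m1 * m2 * x0; - m1 * m2 * y0;
          - m1 * m2 * x2 + m1 / 2 * t * y2; - m1 * m2 * y2 - m1 / 2 * t * x2;
          - m1 * m2 * u + 1; - m1 * m2 * v]].

Lemma vfieldE (E : 'M[R[i]]_4) (p : pt R) (k : 'I_3) :
  vfield E p k 0 = E (inord k) 0 * z1 p + E (inord k) 1 * z2 p
                + E (inord k) 2%:R * zw p + E (inord k) 3%:R.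
Proof. by rewrite mxE. Qed.

Lemma coords5_graph_pt x v : coords5 (graph_pt x v) = x.
Proof.
apply: funext => -[[|[|[|[|[|//]]]]] lti];
  rewrite /coords5 /z1 /z2 /zw /graph_pt !mxE /=;
  by congr x; apply: val_inj.
Qed.

Lemma vfield_basisE m1 m2 t k x v :
  let q := vfield (basis_field m1 m2 t k) (graph_pt x v) in
  let s := nth [::] (basis_field_re m1 m2 t x v) k in
  [/\ z1 q = nth 0 s 0 +i* nth 0 s 1, z2 q = nth 0 s 2 +i* nth 0 s 3
     & zw q = nth 0 s 4 +i* nth 0 s 5].
Proof.
have e2 : (1 / 2 : R[i]) = (1 / 2)%:C by rewrite rmorphM fmorphV rmorph1 rmorph_nat.
case: k => -[|[|[|[|[|//]]]]] /= lti; rewrite /basis_field [nth _ _ _]/=;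
split; rewrite /z1 /z2 /zw vfieldE /z1 /z2 /zw /E1 /E2 /E3 /E4 /E5 /mx4 !mxE;
rewrite inordK //= ?e2;
apply/eqP; rewrite eq_complex /=; apply/andP; split; apply/eqP; by field.

Qed.
(** The norm of [R[i]] takes values in [R[i]]; passing to [Normc.normc] keeps the estimates in
    [R]. *)
Lemma normCE (z : R[i]) : `|z| = (Normc.normc z)%:C.
Proof. by case: z. Qed.

Lemma normc_ge0 (z : R[i]) : 0 <= Normc.normc z.
Proof. by case: z => a b; exact: sqrtr_ge0. Qed.

Lemma normcD (z w : R[i]) :
  Normc.normc (z + w) <= Normc.normc z + Normc.normc w.
Proof. by rewrite -lecR rmorphD /= -!normCE ler_normD. Qed.

Lemma normc_Re (z : R[i]) : `|complex.Re z| <= Normc.normc z.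
Proof. by rewrite -lecR -normCE normc_ge_Re. Qed.

Lemma normc_Im (z : R[i]) : `|complex.Im z| <= Normc.normc z.
Proof.
case: z => a b; rewrite /= -[leLHS]sqrtr_sqr ler_sqrt ?lerDr ?sqr_ge0//.
by rewrite addr_ge0 ?sqr_ge0.
Qed.

Lemma normc_le (a b s : R) :
  `|a| <= s -> `|b| <= s -> Normc.normc (a +i* b) <= 2 * s.
Proof.
move=> ha hb; have s0 : 0 <= s by apply: le_trans ha.
rewrite /= -[leRHS]ger0_norm ?mulr_ge0// -sqrtr_sqr ler_sqrt ?sqr_ge0//.
have : `|a| ^+ 2 <= s ^+ 2 by rewrite lerXn2r.
have : `|b| ^+ 2 <= s ^+ 2 by rewrite lerXn2r.
rewrite !real_normK ?num_real//; nra.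
Qed.

Lemma graph_pt_normc x v (s : R) : (forall i, `|x i| <= s) -> `|v| <= s ->
  forall k, Normc.normc (graph_pt x v k 0) <= 2 * s.
Proof.
move=> hx hv; case=> -[|[|[|//]]] lti; rewrite /graph_pt mxE [nth _ _ _]/=;
  exact: normc_le.
Qed.

Lemma coords5_le (q : pt R) (s : R) : (forall k, Normc.normc (q k 0) <= s) ->
  forall i, `|coords5 q i| <= s.
Proof.
move=> hq; case=> -[|[|[|[|[|//]]]]] lti; rewrite /coords5 /=;
  first [exact: le_trans (normc_Re _) (hq _) | exact: le_trans (normc_Im _) (hq _)].
Qed.

Lemma coords5D (p q : pt R) (s : R) i :
  coords5 (p + s%:C *: q) i = coords5 p i + s * coords5 q i.
Proof.
case: i => -[|[|[|[|[|//]]]]] lti; rewrite /coords5 /= /z1 /z2 /zw !mxE;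
  by case: (p _ _) => a b; case: (q _ _) => c d; rewrite /=; ring.
Qed.

Lemma imC_zwD (p q : pt R) (s : R) :
  imC (zw (p + s%:C *: q)) = imC (zw p) + s * imC (zw q).
Proof.
rewrite /zw !mxE.
by case: (p _ _) => a b; case: (q _ _) => c d; rewrite /=; ring.
Qed.

Lemma vfield_sum n (c : 'I_n -> R) (E : 'I_n -> 'M[R[i]]_4) p :
  vfield (\sum_k (c k)%:C *: E k) p = \sum_k (c k)%:C *: vfield (E k) p.
Proof.
apply/colP => j; rewrite vfieldE summxE !summxE !mulr_suml -!big_split /=.
by apply: eq_bigr => k _; rewrite !mxE; ring.
Qed.

Lemma coords5_sum n (c : 'I_n -> R) (q : 'I_n -> pt R) i :
  coords5 (\sum_k (c k)%:C *: q k) i = \sum_k c k * coords5 (q k) i.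
Proof.
elim/big_rec2: _ => [|k y1 y2 _ <-].
  by case: i => -[|[|[|[|[|//]]]]] lti; rewrite /coords5 /= /z1 /z2 /zw !mxE.
by rewrite addrC coords5D addrC.
Qed.

Lemma imC_zw_sum n (c : 'I_n -> R) (q : 'I_n -> pt R) :
  imC (zw (\sum_k (c k)%:C *: q k)) = \sum_k c k * imC (zw (q k)).
Proof.
elim/big_rec2: _ => [|k y1 y2 _ <-]; first by rewrite /zw !mxE.
by rewrite addrC imC_zwD addrC.
Qed.

(** * The fields as a frame near 0 *)

(** Columns 0 to 4 give the velocity of the graph parameters [x], column 5 that of Im w. *)
Definition frame m1 m2 t x v (k i : nat) : R :=
  nth 0 (nth [::] (basis_field_re m1 m2 t x v) k) i.

Lemma coords5_basis m1 m2 t k x v i :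
  coords5 (vfield (basis_field m1 m2 t k) (graph_pt x v)) i
    = frame m1 m2 t x v k i.
Proof.
rewrite /coords5 /frame; have [-> -> ->] := vfield_basisE m1 m2 t k x v.
by case: i => -[|[|[|[|[|//]]]]].
Qed.

Lemma imC_zw_basis m1 m2 t k x v :
  imC (zw (vfield (basis_field m1 m2 t k) (graph_pt x v)))
    = frame m1 m2 t x v k 5.
Proof. by have [_ _ ->] := vfield_basisE m1 m2 t k x v. Qed.

Lemma vfield_sub_le (E : 'M[R[i]]_4) (p : pt R) (s : R) :
  (forall k, Normc.normc (p k 0) <= s) ->
  forall k, Normc.normc ((vfield E p - vfield E 0) k 0)
    <= (\sum_i \sum_j Normc.normc (E i j)) * s.
Proof.
move=> hp k; have n0 := normc_ge0.
have s0 : 0 <= s := le_trans (n0 _) (hp 0).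
pose a : 'I_4 := inord k.
have -> : (vfield E p - vfield E 0) k 0
    = E a 0 * p 0 0 + E a 1 * p 1 0 + E a 2%:R * p 2%:R 0.
  by rewrite !mxE /z1 /z2 /zw !mxE /a; ring.
apply: (@le_trans _ _ ((\sum_j Normc.normc (E a j)) * s)); last first.
  rewrite ler_wpM2r// [leRHS](bigD1 a)//= lerDl.
  by do 2![apply: sumr_ge0 => ? _].
have h j l : Normc.normc (E a l * p j 0) <= Normc.normc (E a l) * s.
  by rewrite Normc.normcM ler_wpM2l.
apply: le_trans (normcD _ _) _.
apply: le_trans (lerD (normcD _ _) (lexx _)) _.
apply: le_trans (lerD (lerD (h _ _) (h _ _)) (h _ _)) _.
rewrite -!mulrDl ler_wpM2r//.
rewrite [leRHS](bigD1 0)//= (bigD1 1)//= (bigD1 2%:R)//= !addrA lerDl.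
exact: sumr_ge0.
Qed.

(** At the origin the five fields are the unit translations in the five parameters, and affine
    fields deviate from their value at the origin at most linearly. *)
Lemma frame_small m1 m2 t : exists2 K, 0 <= K & forall (s : R) x v,
  (forall i, `|x i| <= s) -> `|v| <= s ->
  forall k i : 'I_5, `|frame m1 m2 t x v k i - (k == i)%:R| <= K * s.
Proof.
pose N (E : 'M[R[i]]_4) := \sum_i \sum_j Normc.normc (E i j).
have N0 E : 0 <= N E.
  by do 2![apply: sumr_ge0 => ? _]; exact: normc_ge0.
exists (2 * \sum_k N (basis_field m1 m2 t k)).
  by rewrite mulr_ge0// sumr_ge0.
move=> s x v hx hv k i.
have -> : (k == i)%:R = coords5 (vfield (basis_field m1 m2 t k) 0) i.
  have -> : 0 = graph_pt (fun=> 0) 0.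
    by apply/colP => -[[|[|[|//]]] lti]; rewrite !mxE.
  rewrite coords5_basis /frame.
  by case: k i => -[|[|[|[|[|//]]]]] ltk [[|[|[|[|[|//]]]]] lti] /=; ring.
rewrite -coords5_basis -[_ - _]addrC -mulN1r addrC -coords5D.
rewrite rmorphN1 scaleN1r.
apply: coords5_le => j; apply: le_trans (vfield_sub_le _ (graph_pt_normc hx hv) _) _.
rewrite [leRHS]mulrAC mulrC ler_wpM2l//.
  by rewrite mulr_ge0// (le_trans _ hv).
by rewrite (bigD1 k)//= lerDl sumr_ge0.
Qed.

Lemma frame_solve m1 m2 t : exists2 e, 0 < e & forall x v,
  (forall i, `|x i| <= e) -> `|v| <= e ->
  forall (xi : 'I_5 -> R) (d : R), (forall i, `|xi i| <= d) ->
  exists2 c : 'I_5 -> R,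
    forall i, xi i = \sum_k c k * frame m1 m2 t x v k i
    & forall k, `|c k| <= 2 * d.
Proof.
have [K K0 hK] := frame_small m1 m2 t.
(* This radius makes the deviation at most 1/10, the threshold [(2 * n%:R)^-1] for 5 by 5
   matrices. *)
exists (10 * (K + 1))^-1; first by rewrite invr_gt0; lra.
move=> x v hx hv xi d hxi.
pose D : 'M[R]_5 := \matrix_(k, i) (frame m1 m2 t x v k i - (k == i)%:R).
have [|j|c hc cd] := @near1_solve _ D (\row_i xi i) d.
- move=> i j; rewrite mxE (le_trans (hK _ _ _ hx hv _ _))//.
  rewrite ler_pdivrMr; last by lra.
  rewrite mulrC ler_pdivlMr; lra.
- by rewrite mxE.
exists (fun k => c 0 k) => // i.
have := congr1 (fun A : 'rV[R]_5 => A 0 i) hc; rewrite !mxE => <-.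
apply: eq_bigr => k _; rewrite !mxE; congr (_ * _); ring.
Qed.

(** * Smallness of F near 0 and tangency along straight lines *)

Lemma normal_form_small (F : ('I_5 -> R) -> R) (e : R) :
  normal_form F -> 0 < e ->
  exists2 d, 0 < d & forall x, (forall i, `|x i| <= d) -> `|F x| <= e.
Proof.
move=> [G [FG [c /power_series_small hc c0]]] e0.
have [r [M [r0 hG]]] := hc c0.
(* On the box of size [s * r] the quadratic part is at most [4 * s * r ^+ 2], with 4 = 2 + 1 + 1,
   and [G] at most [s * M]; the summand 1 makes [A] positive. *)
pose A := 4 * r ^+ 2 + `|M| + 1.
have A0 : 0 < A by rewrite /A; have := normr_ge0 M; have := sqr_ge0 r; lra.
pose s := Num.min 1 (e / A).
have s0 : 0 < s by rewrite lt_min ltr01 divr_gt0.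
have s1 : s <= 1 by rewrite ge_min lexx.
have sA : s * A <= e by rewrite -ler_pdivlMr// ge_min lexx orbT.
exists (s * r) => [|x hx]; first exact: mulr_gt0.
have hGx : `|G x| <= s * M by apply: hG => //; rewrite s1 ltW.
have hsq i : `|x i ^+ 2| <= s * r ^+ 2.
  rewrite normrX (@le_trans _ _ ((s * r) ^+ 2))//.
    by rewrite lerXn2r ?nnegrE ?hx// mulr_ge0 ?ltW.
  by rewrite exprMn ler_wpM2r ?sqr_ge0// expr2 ler_piMl// ltW.
have := hsq 0; have := hsq 2%:R; have := hsq 3%:R.
rewrite FG; move: hGx sA; rewrite /A.
have hr : 0 <= r ^+ 2 := sqr_ge0 r.
move=> hGx sA h3 h2 h1.
apply: le_trans (ler_normD _ _) _.
apply: le_trans (lerD (ler_normD _ _) (lexx _)) _.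
apply: le_trans (lerD (lerD (ler_normD _ _) (lexx _)) (lexx _)) _.
have : s * M <= s * `|M| by rewrite ler_wpM2l ?ler_norm// ltW.
rewrite normrM ger0_norm//; lra.
Qed.

(** Along the line in direction [Z], [defun F] differs from [F] only by Im w, which is affine in
    [s]; its vanishing derivative therefore prescribes that of [F]. *)
Lemma tangent_ray Z F rho x xi :
  tangent_on Z F (graph_hyp F rho) -> graph_hyp F rho (graph_pt x (F x)) ->
  coords5 (vfield Z (graph_pt x (F x))) = xi ->
  is_derive (0 : R) (1 : R) (fun s : R => F (fun i => x i + s * xi i))
    (imC (zw (vfield Z (graph_pt x (F x))))).
Proof.
move=> tZ hp hxi; set q := vfield Z _ in hxi *.
have dq := tZ _ hp; rewrite -/q in dq.
have -> : (fun s : R => F (fun i => x i + s * xi i)) =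
    (fun s => defun F (graph_pt x (F x) + s%:C *: q)
              + (F x + s * imC (zw q))).
  apply: funext => s; rewrite /defun imC_zwD.
  have -> : imC (zw (graph_pt x (F x))) = F x by rewrite /zw mxE.
  have -> : coords5 (graph_pt x (F x) + s%:C *: q) = (fun i => x i + s * xi i).
    by apply: funext => i; rewrite coords5D coords5_graph_pt hxi.
  by rewrite subrK.
by apply: is_derive_eq; rewrite /GRing.scale /=; ring.
Qed.

Lemma sum_ord5 (V : nmodType) (f : 'I_5 -> V) :
  \sum_k f k = f 0 + f 1 + f 2%:R + f 3%:R + f 4%:R.
Proof.
rewrite !big_ord_recl big_ord0 addr0 !addrA.
by do ![congr (_ + _)]; congr f; apply: val_inj.
Qed.

Lemma in_g_sum m1 m2 t (c : 'I_5 -> R) :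
  in_g m1 m2 t (\sum_k (c k)%:C *: basis_field m1 m2 t k).
Proof.
by exists c; rewrite sum_ord5.
Qed.

Lemma graph_hyp_pt F (rho : R) x (s : R) :
  (forall i, `|x i| <= s) -> `|F x| <= s -> 2 * s < rho ->
  graph_hyp F rho (graph_pt x (F x)).
Proof.
move=> hx hF hs; split; last by rewrite coords5_graph_pt /zw mxE.
by move=> k; rewrite normCE ltcR (le_lt_trans (graph_pt_normc hx hF k)).
Qed.

(** * The invariant quadric and its coincidence with M near 0 *)

(* X and Y are the real and imaginary parts of zeta = z1 - (i m1 / 2) w. *)
Definition quadric (m1 m2 : R) x v : R :=
  let X := x 0 + m1 / 2 * v in let Y := x 1 - m1 / 2 * x 4%:R in
  v - 2 * X ^+ 2 - (x 2%:R ^+ 2 + x 3%:R ^+ 2) + 2 * m2 * v * Y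
  + m2 ^+ 2 / 2 * v ^+ 2.

(** Differential of [quadric] at ([x], [v]) on the vector ([xi], [w]). *)
Definition quadric_diff (m1 m2 : R) x v (xi : 'I_5 -> R) (w : R) : R :=
  let X := x 0 + m1 / 2 * v in let Y := x 1 - m1 / 2 * x 4%:R in
  w - 4 * X * (xi 0 + m1 / 2 * w) - 2 * (x 2%:R * xi 2%:R + x 3%:R * xi 3%:R)
  + 2 * m2 * (w * Y + v * (xi 1 - m1 / 2 * xi 4%:R)) + m2 ^+ 2 * v * w.

(** Relative invariance, as a polynomial identity: E1, E3 and E4 annihilate the quadric, E2 scales
    it by [4 * m2] and E5 by [- 2 * m1 * m2], so the translation E5 + (m1 / 2) E2 preserves it. *)
Lemma quadric_flow m1 m2 t x v (c : 'I_5 -> R) :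
  quadric_diff m1 m2 x v (fun i => \sum_k c k * frame m1 m2 t x v k i)
    (\sum_k c k * frame m1 m2 t x v k 5)
  = (4 * m2 * c 1 - 2 * m1 * m2 * c 4%:R) * quadric m1 m2 x v.
Proof.
by rewrite /quadric_diff /quadric !sum_ord5 /frame /basis_field_re /=; field.
Qed.

Lemma quadric_ray_derive m1 m2 x (g : R -> R) (t w : R) :
  is_derive t 1 g w ->
  is_derive t 1 (fun s => quadric m1 m2 (fun i => s * x i) (g s))
    (quadric_diff m1 m2 (fun i => t * x i) (g t) x w).
Proof.
move=> dg; rewrite /quadric /quadric_diff.
apply: is_derive_eq; rewrite /GRing.scale /=; by field.
Qed.

Lemma graph_sub_quadric m1 m2 t F (rho e0 : R) :
  integral_variety (in_g m1 m2 t) F rho -> 0 < e0 ->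
  exists2 d, 0 < d & forall x, (forall i, `|x i| <= d) ->
    `|F x| <= e0 /\ quadric m1 m2 x (F x) = 0.
Proof.
move=> [rho0 nF tF] e00.
have [e1 e10 he1] := frame_solve m1 m2 t.
(* [e1] makes the fields a frame, and [rho / 3] keeps the graph points, of modulus at most [2 * e],
   inside the domain of M. *)
pose e := Num.min e0 (Num.min e1 (rho / 3)).
have ee : 0 < e by rewrite !lt_min e00 e10 divr_gt0.
have [ee0 ee1 er] : [/\ e <= e0, e <= e1 & e <= rho / 3].
  by rewrite !ge_min !lexx !orbT.
have [d1 d10 hd1] := normal_form_small nF ee.
exists (Num.min d1 e) => [|x hx]; first by rewrite lt_min d10.
have {}hx i : `|x i| <= d1 /\ `|x i| <= e.
  by have := hx i; rewrite le_min => /andP.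
have hF : `|F x| <= e by apply: hd1 => i; have [] := hx i.
split; first exact: le_trans ee0.
pose g s := F (fun i => s * x i).
have tx s : 0 <= s <= 1 ->
    (forall i, `|s * x i| <= d1) /\ (forall i, `|s * x i| <= e).
  move=> /andP[s0 s1]; split=> i; rewrite normrM ger0_norm//;
    have [h1 h2] := hx i; rewrite (le_trans (ler_piMl _ _))//.
have F0 : F (fun=> 0) = 0.
  apply/eqP; rewrite -normr_le0; apply/ler_addgt0Pl => e' e'0.
  rewrite addr0; have [d2 d20] := normal_form_small nF e'0; apply => i.
  by rewrite normr0 ltW.
have ex1 : (fun i => 1 * x i) = x by apply: funext => i; rewrite mul1r.
have ex0 : (fun i => 0 * x i) = (fun=> 0) by apply: funext => i; rewrite mul0r.
(* Bounds the invariance factor, since the frame coefficients are at most [2 * e]. *)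
pose K := 2 * e * (`|4 * m2| + `|2 * m1 * m2|).
have := @gronwall0 (fun s => quadric m1 m2 (fun i => s * x i) (g s)) K.
rewrite /g ex0 ex1 F0 => -> //; last first.
  by rewrite /quadric; ring.
move=> s s01; have [sd se] := tx s s01.
have gse : `|g s| <= e := hd1 _ sd.
(* Choose the element of g whose parameter velocity at the point over [s * x] is the ray direction
   [x]. *)
have [|||c hc ce] := he1 (fun i => s * x i) (g s) _ _ x e.
- by move=> i; apply: le_trans ee1.
- exact: le_trans ee1.
- by move=> i; have [] := hx i.
pose Z : 'M[R[i]]_4 := \sum_k (c k)%:C *: basis_field m1 m2 t k.
have dG := tangent_ray (xi := x) (tF Z (in_g_sum _ _ _ _)) (x := fun i => s * x i).
have dg : is_derive s 1 g (\sum_k c k * frame m1 m2 t (fun i => s * x i) (g s) k 5).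
  have -> : \sum_k c k * frame m1 m2 t (fun i => s * x i) (g s) k 5
      = imC (zw (vfield Z (graph_pt (fun i => s * x i) (g s)))).
    rewrite vfield_sum imC_zw_sum; apply: eq_bigr => k _.
    by rewrite imC_zw_basis.
  (* Tangency gives a derivative at time 0 on the line starting at [s * x]; a shift of time carries
     it to [g] at [s]. *)
  have gE : g = (fun s' => F (fun i => s * x i + s' * x i)) \o (fun s' => s' - s).
    by apply: funext => s' /=; congr F; apply: funext => i; ring.
  set w := imC _.
  have dw : is_derive (0 : R) 1 (fun s' => F (fun i => s * x i + s' * x i)) w.
    apply: dG; first by apply: (graph_hyp_pt se gse); lra.
    apply: funext => i; rewrite vfield_sum coords5_sum [RHS]hc.
    by apply: eq_bigr => j _; rewrite coords5_basis.
  clearbody w; rewrite gE -[w]mulr1; apply: is_derive1_comp.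
    by rewrite subrr.
  by apply: is_derive_eq; rewrite subr0.
exists (4 * m2 * c 1 - 2 * m1 * m2 * c 4%:R).
  have := quadric_ray_derive m1 m2 x dg.
  rewrite [X in quadric_diff _ _ _ _ X _](_ : x = fun i =>
    \sum_k c k * frame m1 m2 t (fun i => s * x i) (g s) k i); last exact: funext.
  by rewrite quadric_flow.
rewrite /K mulrDr (le_trans (ler_normB _ _))// !(normrM _ (c _)).
by rewrite lerD// mulrC ler_wpM2r.
Qed.

(** The difference of the two values factors as [(v - w) * (1 - k)], where [k] is small near 0. *)
Lemma quadric_inj m1 m2 : exists2 e, 0 < e & forall x v w,
  (forall i, `|x i| <= e) -> `|v| <= e -> `|w| <= e ->
  quadric m1 m2 x v = 0 -> quadric m1 m2 x w = 0 -> v = w.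
Proof.
pose B := `|m1| + `|m2| + 1.
have B1 : 1 <= B by rewrite lerDr addr_ge0.
exists (10 * B ^+ 2)^-1.
  by rewrite invr_gt0 mulr_gt0// exprn_gt0// (lt_le_trans _ B1).
move=> x v w hx hv hw qv qw.
set e := (10 * B ^+ 2)^-1 in hx hv hw.
pose k := m1 * (2 * x 0 + m1 / 2 * (v + w)) - 2 * m2 * (x 1 - m1 / 2 * x 4%:R)
   - m2 ^+ 2 / 2 * (v + w).
have : (v - w) * (1 - k) = 0.
  by rewrite -[RHS](subrr 0) -{1}qv -qw /quadric /k; field.
suff : `|k| < 1.
  move=> k1 /eqP; rewrite mulf_eq0 !subr_eq0 => /orP[/eqP//|/eqP k1E].
  by move: k1; rewrite -k1E normr1 ltxx.
have eB : e * B ^+ 2 = 10^-1.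
  rewrite /e; field; apply/eqP; lra.
have e0 : 0 <= e by apply: le_trans hv.
have [m1B m2B] : `|m1| <= B /\ `|m2| <= B.
  by rewrite /B; split; have := normr_ge0 m1; have := normr_ge0 m2; lra.
have hM (a b c d : R) : `|a| <= c -> `|b| <= d -> `|a * b| <= c * d.
  by move=> ac bd; rewrite normrM ler_pM.
have hD (a b c d : R) : `|a| <= c -> `|b| <= d -> `|a + b| <= c + d.
  by move=> ac bd; rewrite (le_trans (ler_normD _ _)) ?lerD.
have h2 : `|2 : R| <= 2 by rewrite ger0_norm.
have hN (a c : R) : `|a| <= c -> `|- a| <= c by rewrite normrN.
have h12 : `|2^-1 : R| <= 2^-1 by rewrite ger0_norm ?invr_ge0.
(* The bound adds up to [4 * e * B + 3 * e * B ^+ 2], at most 7/10 because [e * B ^+ 2] is 1/10 and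
   [B] is at least 1. *)
have hk : `|k| <= B * (2 * e + B * 2^-1 * (e + e))
    + 2 * B * (e + B * 2^-1 * e) + B * B * 2^-1 * (e + e).
  apply: (hD); [apply: (hD)|].
  - by apply: (hM) => //; apply: (hD);
      [exact: (hM) | apply: (hM); [exact: (hM) | exact: (hD)]].
  - apply: (hN); apply: (hM); first exact: (hM).
    by apply: (hD) => //; apply: (hN); apply: (hM) => //; exact: (hM).
  - by apply: (hN); apply: (hM); [apply: (hM) => //; exact: (hM) | exact: (hD)].
apply: le_lt_trans hk _.
have : e * B <= e * B ^+ 2 by rewrite ler_wpM2l// expr2 ler_peMl//; lra.
move: eB; lra.
Qed.

(** For the converse inclusion, Im w and [F] at the same parameters are both small roots of the
    quadric, hence equal. *)
Lemma graph_germ m1 m2 t F (rho : R) :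
  integral_variety (in_g m1 m2 t) F rho ->
  exists2 d, 0 < d & forall p : pt R, (forall i, `|p i 0| < d%:C) ->
    graph_hyp F rho p <-> quadric m1 m2 (coords5 p) (imC (zw p)) = 0.
Proof.
move=> iv; have rho0 : 0 < rho by case: iv.
have [e e0 qinj] := quadric_inj m1 m2.
have [d d0 hd] := graph_sub_quadric iv e0.
exists (Num.min rho (Num.min d e)) => [|p hp]; first by rewrite !lt_min rho0 d0.
have {}hp i : [/\ Normc.normc (p i 0) < rho, Normc.normc (p i 0) <= d
                & Normc.normc (p i 0) <= e].
  have := hp i; rewrite normCE ltcR !lt_min => /and3P[? ? ?].
  by split=> //; exact: ltW.
have pd i : `|coords5 p i| <= d by apply: coords5_le => k; have [] := hp k.
have pe i : `|coords5 p i| <= e by apply: coords5_le => k; have [] := hp k.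
have [Fe QF] := hd _ pd.
split=> [[_ ->]//|Qp]; split=> [i|].
  by rewrite normCE ltcR; have [] := hp i.
apply: qinj Qp QF => //; apply: le_trans (normc_Im _) _; have [] := hp 2%:R => //.
Qed.

(** * Affine equivalence of germs and the two models *)

Lemma normc_mulmx m n (A : 'M[R[i]]_(m, n.+1)) (p : 'cV[R[i]]_n.+1) (s : R) :
  (forall k, Normc.normc (p k 0) <= s) ->
  forall k, Normc.normc ((A *m p) k 0)
    <= (\sum_i \sum_j Normc.normc (A i j)) * s.
Proof.
move=> hp k; have n0 := normc_ge0.
apply: (@le_trans _ _ ((\sum_j Normc.normc (A k j)) * s)); last first.
  rewrite ler_wpM2r ?(le_trans _ (hp 0))// [leRHS](bigD1 k)//= lerDl.
  by do 2![apply: sumr_ge0 => ? _].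
rewrite -lecR -normCE mxE (le_trans (ler_norm_sum _ _ _))//.
rewrite rmorphM rmorph_sum mulr_suml; apply: ler_sum => j _.
by rewrite normrM !normCE ler_wpM2l// lecR.
Qed.

Lemma germ_aff_equiv (M N : set (pt R)) (L L' : 'M[R[i]]_3) (b : pt R) (d : R) :
  0 < d -> L *m L' = 1%:M ->
  (forall p : pt R, (forall i, `|p i 0| < d%:C) -> M p <-> N (L *m p + b)) ->
  aff_equiv_to M N.
Proof.
move=> d0 LL' MN; have L'L : L' *m L = 1%:M by exact: mulmx1C.
exists L, b; split; first by have [] := mulmx1_unit LL'.
pose U : set (pt R) := [set p | forall i, `|p i 0| < d%:C].
(* Affine preimages of the polydisc are open; this serves both [U] itself and its image, written as
   a preimage under the inverse map. *)
have openU (A : 'M[R[i]]_3) (a : pt R) : open3 [set q | U (A *m q + a)].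
  move=> p Up.
  pose K : R := 1 + \sum_i \sum_j Normc.normc (A i j).
  have n0 := normc_ge0.
  have K0 : 0 < K.
    by rewrite ltr_pwDl// sumr_ge0// => i _; rewrite sumr_ge0.
  have Up' i : 0 < d - Normc.normc ((A *m p + a) i 0).
    by rewrite subr_gt0 -ltcR -normCE.
  pose e := \big[Num.min/1]_i (d - Normc.normc ((A *m p + a) i 0)).
  have e0 : 0 < e by rewrite lt_bigmin.
  exists (e / K) => [|q hq i]; first by rewrite divr_gt0.
  have -> : A *m q + a = (A *m p + a) + A *m (q - p).
    by rewrite mulmxBr addrAC [A *m p + _]addrC subrK.
  rewrite normCE ltcR mxE (le_lt_trans (normcD _ _))// -ltrBrDl.
  apply: (@lt_le_trans _ _ e); last by rewrite bigmin_le_cond.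
  apply: (@le_lt_trans _ _ ((K - 1) * (e / K))).
    have -> : K - 1 = \sum_i \sum_j Normc.normc (A i j) by rewrite /K addrC addKr.
    apply: normc_mulmx => j.
    have -> : (q - p) j 0 = q j 0 - p j 0 by rewrite !mxE.
    by have := hq j; rewrite normCE ltcR => /ltW.
  rewrite mulrCA mulrBl mul1r divff ?gt_eqF// mulrBr mulr1 gtrBl mulr_gt0//.
  by rewrite invr_gt0.
exists U, [set q | U (L' *m q - L' *m b)]; split.
- by have := openU 1%:M 0; under eq_set do rewrite mul1mx addr0.
- by move=> i; rewrite mxE normr0 ltcR.
- exact: openU.
apply/seteqP; split=> [_ [p [Mp Up] <-]|q [Nq Uq]].
  split; first exact/MN.
  by rewrite /= mulmxDr addrK mulmxA L'L mul1mx.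
exists (L' *m q - L' *m b).
  split=> //; apply/MN => //.
  by rewrite mulmxBr !mulmxA LL' !mul1mx subrK.
by rewrite mulmxBr !mulmxA LL' !mul1mx subrK.
Qed.

Definition mx3 (rows : seq (seq R[i])) : 'M[R[i]]_3 :=
  \matrix_(i < 3, j < 3) nth 0 (nth [::] rows i) j.

Lemma mx3_mul (A : seq (seq R[i])) (p : pt R) (k : 'I_3) :
  (mx3 A *m p) k 0 = nth 0 (nth [::] A k) 0 * z1 p
    + nth 0 (nth [::] A k) 1 * z2 p + nth 0 (nth [::] A k) 2 * zw p.
Proof.
rewrite mxE !big_ord_recl big_ord0 addr0 addrA !mxE /z1 /z2 /zw.
by congr (_ + _ * p _ _); [congr (_ + _ * p _ _)|]; apply: val_inj.
Qed.

Lemma graph_pt_coords p : graph_pt (coords5 p) (imC (zw p)) = p.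
Proof.
have cE (z : R[i]) : z = complex.Re z +i* complex.Im z by case: z.
apply/colP => -[[|[|[|//]]] lti]; rewrite mxE /coords5 /= /z1 /z2 /zw /reC /imC.
all: rewrite [RHS]cE; congr (complex.Re (p _ _) +i* complex.Im (p _ _)).
all: by apply: val_inj.
Qed.

(** The map replaces z1 by zeta; with m2 = 0 the quadric is then literally model 1. *)
Lemma aff_equiv_model1 m1 F (rho d : R) : 0 < d ->
  (forall p : pt R, (forall i, `|p i 0| < d%:C) ->
    graph_hyp F rho p <-> quadric m1 0 (coords5 p) (imC (zw p)) = 0) ->
  aff_equiv_to (graph_hyp F rho) (@model1 R).
Proof.
move=> d0 germ; pose a : R[i] := 0 +i* (m1 / 2).
apply: (germ_aff_equiv (b := 0)
  (L := mx3 [:: [:: 1; 0; - a]; [:: 0; 1; 0]; [:: 0; 0; 1]])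
  (L' := mx3 [:: [:: 1; 0; a]; [:: 0; 1; 0]; [:: 0; 0; 1]]) d0).
  apply/matrixP => i j; rewrite !mxE !big_ord_recl big_ord0 !mxE /=.
  by case: i j => -[|[|[|//]]] lti [[|[|[|//]]] ltj] /=; ring.
move=> p /germ ->; rewrite -{3}(graph_pt_coords p).
move: (coords5 p) (imC (zw p)) => x v.
rewrite /model1 /z1 /z2 /zw /= addr0 !mx3_mul /z1 /z2 /zw !mxE /= /quadric.
rewrite /reC /imC /=.
split => h; nra.
Qed.

(** The new coordinates are z1' = (2 / m2) zeta + i / m2^2, z2' = (sqrt 2 / m2) z2 and w' = w + z1'.
    Then (Im w')^2 - (Im z1')^2 = v (v + 2 Im z1') absorbs the terms in v, and (Im w')^2 - |z1'|^2 -
    |z2'|^2 = (2 / m2^2) Q. *)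
Lemma aff_equiv_model2 m1 m2 F (rho d : R) : 0 < d -> m2 != 0 ->
  (forall p : pt R, (forall i, `|p i 0| < d%:C) ->
    graph_hyp F rho p <-> quadric m1 m2 (coords5 p) (imC (zw p)) = 0) ->
  aff_equiv_to (graph_hyp F rho) (@model2 R).
Proof.
move=> d0 m20 germ.
have [r [r0 r2]] : exists r : R, r != 0 /\ r ^+ 2 = 2.
  by exists (Num.sqrt 2); rewrite sqr_sqrtr// sqrtr_eq0 -ltNge.
pose k : R := 2 / m2.
pose b : pt R := \col_(i < 3) nth 0 [:: 0 +i* (m2 ^- 2); 0; 0 +i* (m2 ^- 2)] i.
apply: (germ_aff_equiv (b := b)
  (L := mx3 [:: [:: k%:C; 0; 0 +i* (- (m1 / m2))];
                [:: 0; (r / m2)%:C; 0];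
                [:: k%:C; 0; 1 +i* (- (m1 / m2))]])
  (L' := mx3 [:: [:: (m2 / 2) +i* (- (m1 / 2)); 0; 0 +i* (m1 / 2)];
                 [:: 0; (m2 / r)%:C; 0];
                 [:: -1; 0; 1]]) d0).
  apply/matrixP => i j; rewrite !mxE !big_ord_recl big_ord0 !mxE /=.
  case: i j => -[|[|[|//]]] lti [[|[|[|//]]] ltj] /=;
  apply/eqP; rewrite eq_complex /= /k; apply/andP; split;
  apply/eqP; by field; rewrite ?m20 ?r0.
move=> p /germ ->; rewrite -{3}(graph_pt_coords p).
move: (coords5 p) (imC (zw p)) => x v.
have key (a e q : R) : a - e = q * (2 / m2 ^+ 2) -> q = 0 <-> a = e.
  move=> E; split=> [q0|ae]; first by apply/eqP; rewrite -subr_eq0 E q0 mul0r.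
  apply/eqP; move/eqP: E; rewrite ae subrr eq_sym !mulf_eq0 invr_eq0.
  by rewrite expf_eq0 (negPf m20) pnatr_eq0 !orbF.
have mxD (y z : pt R) j : (y + z) j 0 = y j 0 + z j 0 by rewrite mxE.
apply: key; rewrite /z1 /z2 /zw !mxD !mx3_mul /z1 /z2 /zw !mxE /=.
rewrite /reC /imC /quadric /k /=; apply/eqP; rewrite -subr_eq0; apply/eqP.
(* With [r] treated as a free variable, the identity fails only by a multiple of [2 - r ^+ 2]. *)
transitivity ((2 - r ^+ 2) * ((x 2%:R ^+ 2 + x 3%:R ^+ 2) / m2 ^+ 2)).
  by field.
by rewrite r2 subrr mul0r.
Qed.
End AffineQuadrics.

Theorem theorem4p4 (R : realType) (m1 m2 t16 : R)
    (F : ('I_5 -> R) -> R) (rho : R) :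
  integral_variety (in_g m1 m2 t16) F rho ->
  aff_equiv_to (graph_hyp F rho) (@model1 R) \/
  aff_equiv_to (graph_hyp F rho) (@model2 R).
Proof.
move=> /graph_germ[d d0 germ].
have [m20|m20] := eqVneq m2 0.
  by left; rewrite m20 in germ; exact: aff_equiv_model1 d0 germ.
by right; exact: aff_equiv_model2 d0 m20 germ.
Qed.
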